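(* Let $\mathcal{O}\subset\mathfrak{sl}_n(\mathbb{C})$ be a conjugacy class of matrices with simple spectrum, let $\Lambda=\mathrm{diag}(\lambda_1,\dots,\lambda_n)\in\mathcal{O}$, and let $\varphi:\mathcal{U}\to(\Lambda+\mathfrak{l})\times(\Lambda+\mathfrak{l})$, $X\mapsto(Y,Z)$, be the $(Y,Z)$ variables centered at $\Lambda$. Then $\varphi$ transforms the Toda vector field on $\mathcal{U}$ into $$(Y',Z')=\big([Y,i\,\mathrm{Im}\Lambda],\,[Z,-\mathrm{Re}\Lambda]\big).$$ This linear vector field (i) is defined on the entire affine space $(\Lambda+\mathfrak{l})\times(\Lambda+\mathfrak{l})$; (ii) has trajectories whose first projection has compact closure and whose second projection is compact if and only if it is stationary; (iii) decouples in the strictly lower triangular entries $Y_{jk},Z_{\ell m}$ of $Y$ and $Z$.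
   Context: Work in $\mathrm{SL}_n(\mathbb{C})$. The Toda vector field on $\mathfrak{sl}_n(\mathbb{C})$ is $X'=[X,\pi_{\mathfrak{k}}X]$, with $\pi_{\mathfrak{k}}$ the projection onto traceless skew-Hermitian matrices along traceless upper triangular matrices with real diagonal. Let $\mathrm{K}=\mathrm{SU}(n)$, $\mathrm{U}$ the upper triangular determinant one matrices with positive diagonal, $\mathrm{L}$ the lower unipotent triangular matrices, $\mathfrak{l}$ the strictly lower triangular matrices; each $g$ factors uniquely $g=\kappa(g)\nu(g)$ with $\kappa(g)\in\mathrm{K}$, $\nu(g)\in\mathrm{U}$; $\mathcal{C}=\kappa(\mathrm{L})$, $\mathcal{D}=\nu(\mathrm{L})$; $X^g=gXg^{-1}$. Set $\mathcal{U}=\{\Lambda^{(lk)^{-1}}:k\in\mathcal{C},l\in\mathrm{L}\}\subset\mathcal{O}$ (open dense). The $(Y,Z)$ variables are $\varphi(X)=(\Lambda^{l_1^{-1}},\Lambda^{l_2^{-1}})$ where $X=\Lambda^{(l_1k)^{-1}}=\Lambda^{ul_2^{-1}}$ with unique $k\in\mathcal{C}$, $u\in\mathcal{D}$, $l_1,l_2\in\mathrm{L}$; $\varphi$ is a diffeomorphism onto $(\Lambda+\mathfrak{l})\times(\Lambda+\mathfrak{l})$. *)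

(* Defs.v *)
From HB Require Import structures.
From mathcomp Require Import all_boot all_order all_algebra.
From mathcomp Require Import all_classical all_reals all_analysis.
From mathcomp Require Import complex.
Set Implicit Arguments. Unset Strict Implicit. Unset Printing Implicit Defensive.
Import Order.TTheory GRing.Theory Num.Theory.
Import numFieldNormedType.Exports.
Local Open Scope ring_scope.
Local Open Scope classical_set_scope.

Section Toda.
Variable R : realType.
Local Notation C := (R[i]).
Variable m : nat.
Local Notation M := 'M[C]_m.

Definition adjm (g : M) : M := (map_mx Num.conj g)^T.

Definition comm (A B : M) : M := A *m B - B *m A.

Definition conjm (g X : M) : M := g *m X *m invmx g.

Definition SUn : set M := [set k : M | k *m adjm k = 1%:M /\ \det k = 1].
Definition Upos : set M :=
  [set u : M | (forall i j : 'I_m, (j < i)%N -> u i j = 0) /\ \det u = 1 /\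
           (forall i : 'I_m, 0 < u i i)].
Definition Lunip : set M :=
  [set l : M | (forall i j : 'I_m, (i < j)%N -> l i j = 0) /\ (forall i, l i i = 1)].
Definition slower : set M := [set X : M | forall i j : 'I_m, (i <= j)%N -> X i j = 0].

Definition su_alg : set M := [set A : M | adjm A = - A /\ \tr A = 0].
Definition b_alg : set M :=
  [set B : M | (forall i j : 'I_m, (j < i)%N -> B i j = 0) /\
           (forall i, B i i \is Num.real) /\ \tr B = 0].

(* g = kappa(g) nu(g), kappa(g) in K, nu(g) in U : stated relationally *)
Definition KU_fact (g k u : M) : Prop := SUn k /\ Upos u /\ g = k *m u.
Definition calC : set M := [set k : M | exists l u, Lunip l /\ KU_fact l k u].
Definition calD : set M := [set u : M | exists l k, Lunip l /\ KU_fact l k u].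

Variable Lam : M.
Definition calU : set M :=
  [set X : M | exists k l, calC k /\ Lunip l /\ X = conjm (invmx (l *m k)) Lam].

Definition aff : set M := [set Y : M | slower (Y - Lam)].

(* the (Y,Z) variables: phi X = (Y,Z) (graph of phi) *)
Definition phi_rel (X Y Z : M) : Prop :=
  exists k u l1 l2, calC k /\ calD u /\ Lunip l1 /\ Lunip l2 /\
    X = conjm (invmx (l1 *m k)) Lam /\ X = conjm (u *m invmx l2) Lam /\
    Y = conjm (invmx l1) Lam /\ Z = conjm (invmx l2) Lam.

Definition mx_deriv (X : R -> M) (t : R) (D : M) : Prop :=
  forall i j : 'I_m,
    is_derive t (1 : R) (fun s => complex.Re (X s i j)) (complex.Re (D i j)) /\
    is_derive t (1 : R) (fun s => complex.Im (X s i j)) (complex.Im (D i j)).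

Definition iImMx (A : M) : M := map_mx (fun z => 'i * 'Im z) A.
Definition ReMx (A : M) : M := map_mx (fun z => 'Re z) A.

End Toda.

(* Main.v *)
Require Import Defs.
From HB Require Import structures.
From mathcomp Require Import all_boot all_order all_algebra.
From mathcomp Require Import all_classical all_reals all_analysis.
From mathcomp Require Import complex.
From mathcomp Require Import ring lra.
Import Order.TTheory GRing.Theory Num.Theory.
Import numFieldNormedType.Exports.
Local Open Scope ring_scope.
Local Open Scope classical_set_scope.

Set Implicit Arguments.
Unset Strict Implicit.
Unset Printing Implicit Defensive.

(** Write [X = g^-1 Lam g] with [g = l1 k = l2 u^-1].  Since the spectrum is fixed
    and simple, the spectral projections of [X] are polynomials in [X]; hence an
    unnormalised frame [W = D g] is differentiable along the flow.  The LU
    factorisations of [W] and of [W W^*] are rational in their entries and give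
    [D_j / u_jj] and [|D_j|^2], so [u_jj] by a square root, and then every factor is
    differentiable.  Differentiating [g X = Lam g] gives [g' = g P + C g] with [C]
    diagonal.  As [k' k^-1] is skew-Hermitian, the factorisation [g = l1 k] forces
    [C] to be imaginary and [l1' = C l1 - l1 C]; as the diagonals of [u] and of
    [X - P] are real, [g = l2 u^-1] forces [Lam + C] to be real and
    [l2' = (Lam + C) l2 - l2 (Lam + C)].  Hence [C = - i Im Lam].  The linear field
    multiplies the entry [(j, k)] by a constant, purely imaginary for [Y] and real
    for [Z]. *)

(** * Lower triangular matrices ([is_trig_mx]) and, through transposes, upper triangular ones *)

Section TriangularMatrices.
Context {F : fieldType} {n : nat}.
Implicit Types A B L U : 'M[F]_n.

Lemma mulmx_is_trig A B : is_trig_mx A -> is_trig_mx B -> is_trig_mx (A *m B).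
Proof.
move=> /is_trig_mxP tA /is_trig_mxP tB; apply/is_trig_mxP => i j ij.
rewrite mxE big1 // => k _; case: (ltnP i k) => [/tA ->|ki]; first by rewrite mul0r.
by rewrite tB ?mulr0 //; exact: leq_ltn_trans ki ij.
Qed.

Lemma mulmx_trig_diag A B i : is_trig_mx A -> is_trig_mx B ->
  (A *m B) i i = A i i * B i i.
Proof.
move=> /is_trig_mxP tA /is_trig_mxP tB.
rewrite mxE (bigD1 i) //= big1 ?addr0 // => k ki.
case: (ltngtP i k) => [/tA ->|/tB ->|/val_inj ik]; rewrite ?mul0r ?mulr0 //.
by rewrite ik eqxx in ki.
Qed.

(** Strong induction on the row: in entry [(i, j)] of [A *m B] with [i < j], the terms [k > i]
    vanish because [A] is lower triangular and the terms [k < i] by induction, which leaves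
    [A i i * B i j]. *)
Lemma trig_mulmxK A B : is_trig_mx A -> (forall i, A i i != 0) ->
  is_trig_mx (A *m B) -> is_trig_mx B.
Proof.
move=> /is_trig_mxP tA nzA /is_trig_mxP tAB; apply/is_trig_mxP => i.
have [m] := ubnP (val i); elim: m i => // m IH i im j ij.
have := tAB _ _ ij; rewrite mxE (bigD1 i) //= big1 ?addr0; last first.
  move=> k ki; case: (ltngtP i k) => [/tA ->|lki|/val_inj ik]; rewrite ?mul0r //.
    by rewrite IH ?mulr0 //; [exact: leq_trans lki im|exact: ltn_trans lki ij].
  by rewrite ik eqxx in ki.
by move/eqP; rewrite mulf_eq0 (negbTE (nzA i)) => /eqP.
Qed.

Lemma unitmx_trig A : is_trig_mx A -> (A \in unitmx) = [forall i, A i i != 0].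
Proof.
move=> tA; rewrite unitmxE det_trig // unitfE.
by apply/prodf_neq0/forallP => h i; have := h i => //; apply.
Qed.

Lemma trig_unit_diag A i : is_trig_mx A -> A \in unitmx -> A i i != 0.
Proof. by move=> tA; rewrite unitmx_trig // => /forallP. Qed.

Lemma invmx_is_trig A : A \in unitmx -> is_trig_mx A -> is_trig_mx (invmx A).
Proof.
move=> uA tA; apply: (trig_mulmxK tA); first by move=> i; exact: trig_unit_diag.
by rewrite mulmxV // scalar_mx_is_trig.
Qed.

Lemma invmx_trig_diag A i : A \in unitmx -> is_trig_mx A ->
  invmx A i i = (A i i)^-1.
Proof.
move=> uA tA; have := mulmx_trig_diag i tA (invmx_is_trig uA tA).
rewrite mulmxV // mxE eqxx /= => h.
by rewrite -[LHS](mulKf (trig_unit_diag i tA uA)) -h mulr1.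
Qed.

Lemma mulmx_is_uptrig A B :
  is_trig_mx A^T -> is_trig_mx B^T -> is_trig_mx (A *m B)^T.
Proof. by move=> tA tB; rewrite trmx_mul mulmx_is_trig. Qed.

Lemma mulmx_uptrig_diag A B i :
  is_trig_mx A^T -> is_trig_mx B^T -> (A *m B) i i = A i i * B i i.
Proof.
move=> tA tB; have := mulmx_trig_diag i tB tA.
by rewrite -trmx_mul !mxE mulrC.
Qed.

Lemma invmx_is_uptrig A :
  A \in unitmx -> is_trig_mx A^T -> is_trig_mx (invmx A)^T.
Proof. by move=> uA tA; rewrite trmx_inv invmx_is_trig ?unitmx_tr. Qed.

Lemma invmx_uptrig_diag A i : A \in unitmx -> is_trig_mx A^T ->
  invmx A i i = (A i i)^-1.
Proof.
move=> uA tA; have := @invmx_trig_diag A^T i.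
by rewrite -trmx_inv !mxE unitmx_tr => ->.
Qed.

Lemma trig_uptrig_diag A : is_trig_mx A -> is_trig_mx A^T ->
  A = diag_mx (\row_i A i i).
Proof.
move=> /is_trig_mxP tA /is_trig_mxP tA'; apply/matrixP => i j; rewrite !mxE.
case: (ltngtP i j) => [ij|ij|/val_inj ->]; last by rewrite eqxx.
- by rewrite tA // -val_eqE ltn_eqF.
- by have := tA' _ _ ij; rewrite mxE => ->; rewrite -val_eqE gtn_eqF.
Qed.

(** Entry [(i, j)] of the commutation relation reads [(lam_j - lam_i) A_ij = 0]. *)
Lemma comm_diag_mx_inj (lam : 'rV[F]_n) A : injective (lam 0) ->
  A *m diag_mx lam = diag_mx lam *m A -> A = diag_mx (\row_i A i i).
Proof.
move=> inj /matrixP h; apply/matrixP => i j; rewrite !mxE.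
have [->|ij] := eqVneq i j => //.
have := h i j; rewrite mul_mx_diag mul_diag_mx !mxE mulrC => /eqP.
rewrite -subr_eq0 -mulrBl mulf_eq0 subr_eq0 => /orP[/eqP /inj ji|/eqP //].
by rewrite ji eqxx in ij.
Qed.

End TriangularMatrices.

(** * Unipotent, positive upper triangular and unitary factors *)

Section SpecialMatrices.
Context {R : realType} {n : nat}.
Local Notation C := R[i].
Local Notation M := 'M[C]_n.
Implicit Types k u l g : M.

Lemma Lunip_trig l : Lunip l -> is_trig_mx l.
Proof. by move=> [h _]; apply/is_trig_mxP. Qed.

Lemma Lunip_diag l i : Lunip l -> l i i = 1.
Proof. by case. Qed.

Lemma Lunip_unit l : Lunip l -> l \in unitmx.
Proof.
move=> Ll; rewrite unitmx_trig ?Lunip_trig //; apply/forallP => i.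
by rewrite Lunip_diag // oner_neq0.
Qed.

Lemma Lunip_mul l l' : Lunip l -> Lunip l' -> Lunip (l *m l').
Proof.
move=> Ll Ll'; split; first exact/is_trig_mxP/mulmx_is_trig/Lunip_trig/Ll'/Lunip_trig.
by move=> i; rewrite mulmx_trig_diag ?Lunip_trig // !Lunip_diag // mulr1.
Qed.

Lemma Lunip_inv l : Lunip l -> Lunip (invmx l).
Proof.
move=> Ll; split; first exact/is_trig_mxP/invmx_is_trig/Lunip_trig/Ll/Lunip_unit.
by move=> i; rewrite invmx_trig_diag ?Lunip_unit ?Lunip_trig // Lunip_diag // invr1.
Qed.

Lemma Upos_uptrig u : Upos u -> is_trig_mx u^T.
Proof. by move=> [h _]; apply/is_trig_mxP => i j ij; rewrite mxE h. Qed.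

Lemma Upos_unit u : Upos u -> u \in unitmx.
Proof. by move=> [_ [h _]]; rewrite unitmxE h unitr1. Qed.

Lemma Upos_diag_gt0 u i : Upos u -> 0 < u i i.
Proof. by move=> [_ [_ h]]. Qed.

Lemma SUn_unit k : SUn k -> k \in unitmx.
Proof. by move=> [_ h]; rewrite unitmxE h unitr1. Qed.

Lemma SUn_inv k : SUn k -> invmx k = adjm k.
Proof.
move=> Sk; rewrite -[RHS]mul1mx -(mulVmx (SUn_unit Sk)) -mulmxA.
by case: Sk => -> _; rewrite mulmx1.
Qed.

Lemma SUn_mulVmx k : SUn k -> adjm k *m k = 1%:M.
Proof. by move=> Sk; rewrite -SUn_inv // mulVmx // SUn_unit. Qed.

Lemma adjm_mul (A B : M) : adjm (A *m B) = adjm B *m adjm A.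
Proof. by rewrite /adjm map_mxM trmx_mul. Qed.

Lemma adjmE (A : M) i j : adjm A i j = conjc (A j i).
Proof. by rewrite /adjm !mxE. Qed.

Lemma adjmK (A : M) : adjm (adjm A) = A.
Proof. by apply/matrixP => i j; rewrite !adjmE conjcK. Qed.

Lemma adjm_uptrig (A : M) : is_trig_mx A -> is_trig_mx (adjm A)^T.
Proof.
move=> /is_trig_mxP tA; apply/is_trig_mxP => i j ij.
by rewrite mxE adjmE tA // conjc0.
Qed.

(* A unitary triangular matrix is diagonal, since its inverse is its adjoint. *)
Lemma unitary_trig_pos_eq1 (A : M) : A *m adjm A = 1%:M -> is_trig_mx A ->
  (forall i, 0 < A i i) -> A = 1%:M.
Proof.
move=> AA tA pA.
have uA : A \in unitmx by case/mulmx1_unit: AA.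
have iA : invmx A = adjm A by rewrite -[RHS]mul1mx -(mulVmx uA) -mulmxA AA mulmx1.
have tA' : is_trig_mx A^T.
  by rewrite -[A]adjmK; apply: adjm_uptrig; rewrite -iA invmx_is_trig.
rewrite (trig_uptrig_diag tA tA'); apply/matrixP => i j; rewrite !mxE.
case: eqVneq => //= _.
have : (invmx A) i i = A i i.
  rewrite iA adjmE; have := pA i; rewrite ltcE /= => /andP[/eqP].
  by case: (A i i) => a b /= -> _; rewrite oppr0.
rewrite invmx_trig_diag // => h.
have /eqP : A i i ^+ 2 = 1 by rewrite expr2 -{1}h mulVf // gt_eqF.
by rewrite sqrf_eq1 => /orP[/eqP ->//|/eqP hh]; have := pA i; rewrite hh oppr_gt0 ltr10.
Qed.

End SpecialMatrices.

(** * Algebra of the Toda field in a moving eigenframe *)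

Section TodaAlgebra.
Context {R : realType} {n : nat}.
Local Notation C := R[i].
Local Notation M := 'M[C]_n.
Variable lam : 'rV[C]_n.
Hypothesis lam_inj : injective (lam 0).
Local Notation Lam := (diag_mx lam).

Lemma conjm_inv_eq (g X : M) : g \in unitmx -> X = conjm (invmx g) Lam ->
  g *m X = Lam *m g.
Proof. by move=> ug ->; rewrite /conjm invmxK -mulmxA mulKVmx. Qed.

(** The relation [phi_rel] restated without inverses, with one common frame [l1 k = l2 u^-1]: every
    clause is a polynomial identity that can be differentiated directly. *)
Definition yz_data (X Y Z l1 k l2 u : M) : Prop :=
  [/\ [/\ Lunip l1, SUn k, Lunip l2 & Upos u],
      l1 *m k *m u = l2, l1 *m k *m X = Lam *m (l1 *m k),
      l1 *m Y = Lam *m l1 & l2 *m Z = Lam *m l2].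

(* The frames [l1 k] and [l2 u^-1] both diagonalise [X], so they differ by a
   diagonal factor [E], which is positive by uniqueness of the LU factorisation
   and equal to 1 by uniqueness of the QR factorisation. *)
Lemma phi_rel_yz_data (X Y Z : M) : phi_rel Lam X Y Z ->
  exists l1 k l2 u, yz_data X Y Z l1 k l2 u.
Proof.
move=> [k [u [l1 [l2 [[l [uk [Ll [Sk [Uk lE]]]]] [+ [L1 [L2 [X1 [X2 [YE ZE]]]]]]]]]]].
move=> [l' [k' [Ll' [Sk' [Uu l'E]]]]].
have [u1 u2 uU ukU ku] := And5 (Lunip_unit L1) (Lunip_unit L2) (Upos_unit Uu)
  (Upos_unit Uk) (SUn_unit Sk).
have [ul ul' k'u] := And3 (Lunip_unit Ll) (Lunip_unit Ll') (SUn_unit Sk').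
have gX : l1 *m k *m X = Lam *m (l1 *m k) by apply: conjm_inv_eq; rewrite ?unitmx_mul ?u1.
have g2X : l2 *m invmx u *m X = Lam *m (l2 *m invmx u).
  have : X *m (u *m invmx l2) = u *m invmx l2 *m Lam.
    by rewrite {1}X2 /conjm mulmxKV // unitmx_mul uU unitmx_inv.
  move=> /(congr1 (fun A => l2 *m invmx u *m A *m (l2 *m invmx u))).
  by rewrite !mulmxA (mulmxKV u2) (mulmxK uU) (mulmxKV uU) (mulmxV u2) mul1mx.
have ug : l1 *m k \in unitmx by rewrite unitmx_mul u1.
have [g gE] : exists g, g = l1 *m k by exists (l1 *m k).
have [g2 g2E] : exists g2, g2 = l2 *m invmx u by exists (l2 *m invmx u).
rewrite -gE in ug; rewrite -gE in gX; rewrite -g2E in g2X.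
have [E EE] : exists E, E = g2 *m invmx g by exists (g2 *m invmx g).
have {}EE : g2 = E *m g by rewrite EE mulmxKV.
have dE : E = diag_mx (\row_i E i i).
  apply: (comm_diag_mx_inj lam_inj).
  by rewrite -{1}[Lam](mulmxK ug) -gX !mulmxA -EE g2X EE -!mulmxA mulmxV ?mulmx1.
have tE : is_trig_mx E by rewrite dE diag_mx_is_trig.
(* [Q] has two readings: as [l2^-1 E l1 l] it is lower triangular, as [u^-1 uk] it has positive
   diagonal. *)
have [Q Qd] : exists Q, Q = invmx l2 *m E *m l1 *m l by eexists.
have QE : Q = invmx u *m uk.
  rewrite Qd lE; apply: (@can_inj _ _ (mulmx l2) _ (mulKmx u2)).
  by rewrite !mulmxA mulmxV // mul1mx -g2E EE gE !mulmxA.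
have Q0 i : 0 < Q i i.
  rewrite QE mulmx_uptrig_diag ?invmx_is_uptrig ?Upos_uptrig //.
  by rewrite invmx_uptrig_diag ?Upos_uptrig // mulr_gt0 ?invr_gt0 ?Upos_diag_gt0.
have tQ : is_trig_mx Q.
  by rewrite Qd !mulmx_is_trig // ?invmx_is_trig // Lunip_trig.
(* From [k' u = l'] and [k uk = l], the unitary [k' k^-1] equals [l' Q l^-1], which is lower
   triangular with positive diagonal, hence the identity. *)
have k'k : k' *m adjm k = l' *m Q *m invmx l.
  rewrite QE -SUn_inv // l'E lE.
  rewrite !mulmxA mulmxK //.
  apply: (@can_inj _ _ (mulmx^~ (k *m uk)) (mulmx^~ (invmx (k *m uk)))).
    by move=> A; rewrite mulmxK // unitmx_mul ku.
  by rewrite mulmxKV ?unitmx_mul ?ku // mulmxA mulmxKV.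
have kk' : k' *m adjm k = 1%:M.
  apply: unitary_trig_pos_eq1.
  - rewrite adjm_mul adjmK !mulmxA -(mulmxA k') SUn_mulVmx // mulmx1.
    by case: Sk'.
  - by rewrite k'k !mulmx_is_trig // ?invmx_is_trig // Lunip_trig.
  - move=> i; rewrite k'k !mulmx_trig_diag ?mulmx_is_trig //
      ?invmx_is_trig // ?Lunip_trig //.
    by rewrite (Lunip_diag i Ll') (Lunip_diag i (Lunip_inv Ll)) mulr1 mul1r.
have {kk' k'k} kk' : k' = k.
  by rewrite -[k']mulmx1 -(SUn_mulVmx Sk) mulmxA kk' mul1mx.
have l2E : l2 = E *m (l1 *m l').
  by rewrite l'E kk' !mulmxA -(mulmxA E) -gE -EE g2E mulmxKV.
(* Both [l2] and [l1 *m l'] have unit diagonal, so the diagonal matrix [E] between them is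
   trivial. *)
have E1 : E = 1%:M.
  rewrite dE; apply/matrixP => i j; rewrite !mxE; case: eqP => //= _.
  have := Lunip_diag i L2; rewrite l2E.
  have L3 := Lunip_mul L1 Ll'.
  by rewrite mulmx_trig_diag ?(Lunip_trig L3) // (Lunip_diag i L3) mulr1.
exists l1, k, l2, u; split => //.
- by rewrite l2E E1 mul1mx l'E kk' mulmxA.
- by rewrite -gE.
- by rewrite YE /conjm invmxK -mulmxA mulKVmx.
- by rewrite ZE /conjm invmxK -mulmxA mulKVmx.
Qed.

(** The last three hypotheses are the derivatives of [g X = Lam g], [g u = l2] and [k *m adjm k = 1]
    for [g = l1 k], so the determination of [l1'] and [l2'] is pure linear algebra at one time. *)
Lemma toda_frame_derivative (X P l1 k l2 u dl1 dk dl2 du : M) :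
  Lunip l1 -> SUn k -> Lunip l2 -> Upos u ->
  l1 *m k *m u = l2 -> l1 *m k *m X = Lam *m (l1 *m k) ->
  su_alg P -> b_alg (X - P) ->
  slower dl1 -> slower dl2 -> is_trig_mx du^T ->
  (forall i, du i i \is Num.real) ->
  (dl1 *m k + l1 *m dk) *m X + l1 *m k *m comm X P =
    Lam *m (dl1 *m k + l1 *m dk) ->
  (dl1 *m k + l1 *m dk) *m u + l1 *m k *m du = dl2 ->
  dk *m adjm k + k *m adjm dk = 0 ->
  dl1 = comm l1 (iImMx Lam) /\ dl2 = comm l2 (- ReMx Lam).
Proof.
move=> L1 Sk L2 Uu kuE gX [aP _] [tB [rB _]] sl1 sl2 tdu rdu dX du2 dk2.
have [u1 u2 uu uk] := And4 (Lunip_unit L1) (Lunip_unit L2) (Upos_unit Uu) (SUn_unit Sk).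
have kk : k *m adjm k = 1%:M by case: Sk.
have [g gE] : exists g, g = l1 *m k by eexists.
have [dg dgE] : exists dg, dg = dl1 *m k + l1 *m dk by eexists.
have [B BE] : exists B, B = X - P by eexists.
rewrite -BE in tB rB; rewrite -gE -dgE in dX.
rewrite -gE -dgE in du2; rewrite -gE in gX kuE.
have ug : g \in unitmx by rewrite gE unitmx_mul u1.
(* Since [g X P = Lam g P], the differentiated relation becomes [(dg - g P) X = Lam (dg - g P)];
   transported by [g^-1] it says that [Cm] commutes with [Lam]. *)
have [Cm dgC cC] : exists2 Cm, dg = g *m P + Cm *m g & Cm *m Lam = Lam *m Cm.
  exists ((dg - g *m P) *m invmx g); first by rewrite mulmxKV // addrC subrK.
  have gV : invmx g *m Lam = X *m invmx g.
    by rewrite -{1}[Lam](mulmxK ug) -gX !mulmxA mulVmx // mul1mx.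
  rewrite -!mulmxA gV !mulmxA; congr (_ *m _); rewrite mulmxBl mulmxBr -dX.
  by rewrite mulmxA -gX /comm mulmxBr !mulmxA addrA addrAC addrK.
have dC := comm_diag_mx_inj lam_inj cC.
have tC : is_trig_mx Cm by rewrite dC diag_mx_is_trig.
have dl1T : is_trig_mx dl1 by apply/is_trig_mxP => i j ij; rewrite sl1 // ltnW.
have dl2T : is_trig_mx dl2 by apply/is_trig_mxP => i j ij; rewrite sl2 // ltnW.
have tL := diag_mx_is_trig lam.
have subT (A A' : M) : is_trig_mx A -> is_trig_mx A' -> is_trig_mx (A - A').
  move=> /is_trig_mxP tA /is_trig_mxP tA'; apply/is_trig_mxP => i j ij.
  by rewrite !mxE tA // tA' // subr0.
have addT (A A' : M) : is_trig_mx A -> is_trig_mx A' -> is_trig_mx (A + A').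
  move=> /is_trig_mxP tA /is_trig_mxP tA'; apply/is_trig_mxP => i j ij.
  by rewrite !mxE tA // tA' // addr0.
(* [S] is skew-Hermitian because [dk *m adjm k] and [P] are, and lower triangular because
   [l1 S = Cm l1 - dl1]; so it is diagonal. As [dl1] is strictly lower, its diagonal is that of
   [Cm]. *)
have [S SE] : exists S, S = dk *m adjm k - k *m P *m adjm k by eexists.
have l1S : l1 *m S = Cm *m l1 - dl1.
  have : dg *m adjm k = dl1 + l1 *m dk *m adjm k.
    by rewrite dgE mulmxDl -(mulmxA dl1) kk mulmx1.
  rewrite dgC mulmxDl gE -!mulmxA kk mulmx1 => h.
  rewrite SE mulmxBr -!mulmxA -[l1 *m (dk *m _)](addKr dl1) -h.
  by rewrite addrA addrAC addrK addrC.
have tS : is_trig_mx S.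
  apply: (trig_mulmxK (Lunip_trig L1)).
    by move=> i; rewrite Lunip_diag // oner_neq0.
  by rewrite l1S subT // mulmx_is_trig // Lunip_trig.
have aS : adjm S = - S.
  have adjB (A A' : M) : adjm (A - A') = adjm A - adjm A'.
    by apply/matrixP => i j; rewrite !(adjmE, mxE) rmorphB.
  rewrite SE adjB !adjm_mul adjmK aP.
  have -> : k *m adjm dk = - (dk *m adjm k) by apply/eqP; rewrite -addr_eq0 addrC dk2.
  by rewrite !mulNmx !mulmxN mulmxA opprK opprB addrC.
have tS' : is_trig_mx S^T.
  have /is_trig_mxP h := adjm_uptrig tS; apply/is_trig_mxP => i j /h.
  by rewrite aS !mxE => /eqP; rewrite oppr_eq0 => /eqP.
have SC : S = Cm.
  rewrite (trig_uptrig_diag tS tS') dC; congr diag_mx; apply/rowP => i; rewrite !mxE.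
  have := congr1 (fun A : M => A i i) l1S; rewrite /= mulmx_trig_diag ?(Lunip_trig L1) //.
  rewrite [RHS]mxE mulmx_trig_diag ?(Lunip_trig L1) // !(Lunip_diag i L1) mul1r mulr1.
  by rewrite mxE sl1 // oppr0 addr0.
have C_re i : complex.Re (Cm i i) = 0.
  have := congr1 (fun A : M => complex.Re (A i i)) aS; rewrite /= adjmE mxE -SC.
  by case: (S i i) => a b /= /eqP; rewrite -addr_eq0 -mulr2n mulrn_eq0 /= => /eqP ->.
have dl1E : dl1 = Cm *m l1 - l1 *m Cm.
  by rewrite -{2}SC l1S opprB addrC subrK.
(* The counterpart of [S] on the side of [l2 u^-1]: upper triangular with real diagonal by its
   definition, lower triangular by [l2 T = (Lam + Cm) l2 - dl2], hence equal to [Lam + Cm]. *)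
have [T TE] : exists T, T = invmx u *m (B *m u - du) by eexists.
have l2T : l2 *m T = (Lam + Cm) *m l2 - dl2.
  have -> : dl2 = (Lam + Cm) *m l2 - g *m (B *m u - du).
    have PE : P = X - B by rewrite BE opprB addrC subrK.
    rewrite -du2 dgC -kuE PE !mulmxBr !mulmxDl mulNmx gX !mulmxA opprB.
    by rewrite [_ - _ + _]addrAC -!addrA; do 2!congr (_ + _); rewrite addrC.
  by rewrite TE subKr -kuE !mulmxA mulmxK.
have tT : is_trig_mx T.
  apply: (trig_mulmxK (Lunip_trig L2)).
    by move=> i; rewrite Lunip_diag // oner_neq0.
  by rewrite l2T subT // mulmx_is_trig ?addT ?(Lunip_trig L2).
have tBT : is_trig_mx B^T by apply/is_trig_mxP => i j ij; rewrite mxE tB.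
have tu := Upos_uptrig Uu.
have tBu : is_trig_mx (B *m u - du)^T.
  by rewrite linearB /=; apply: subT tdu; exact: mulmx_is_uptrig tBT tu.
have tT' : is_trig_mx T^T.
  by rewrite TE; exact: mulmx_is_uptrig (invmx_is_uptrig uu tu) tBu.
have Td i : T i i = (Lam + Cm) i i.
  have := congr1 (fun A : M => A i i) l2T; rewrite /= mulmx_trig_diag ?(Lunip_trig L2) //.
  rewrite [RHS]mxE mulmx_trig_diag ?(Lunip_trig L2) ?addT //.
  rewrite !(Lunip_diag i L2) mul1r mulr1 => ->.
  by rewrite [(- dl2) i i]mxE sl2 // oppr0 addr0.
have TC : T = Lam + Cm.
  rewrite (trig_uptrig_diag tT tT') dC -linearD /=; congr diag_mx; apply/rowP => i.
  by rewrite mxE Td !mxE eqxx.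
have T_im i : (Lam + Cm) i i \is Num.real.
  rewrite -Td TE (mulmx_uptrig_diag i (invmx_is_uptrig uu tu) tBu).
  rewrite (invmx_uptrig_diag i uu tu) !mxE.
  have ur : u i i \is Num.real by rewrite gtr0_real // Upos_diag_gt0.
  have := mulmx_uptrig_diag i tBT tu; rewrite [LHS]mxE => ->.
  by rewrite realM // ?realV // realB // realM.
(* [Cm] has zero real part and [Lam + Cm] zero imaginary part, which leaves one value. *)
have CE : Cm = - iImMx Lam.
  rewrite dC; apply/matrixP => i j; rewrite !mxE; case: eqVneq => [_|_] /=.
    have := T_im i; have := C_re i; rewrite !mxE eqxx /= -complexIm.
    case: (Cm i i) (lam 0 i) => a b [c d] /= ->; simpc.
    by rewrite complex_real addrC addr_eq0 => /eqP ->; rewrite /GRing.mul /=.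
  by rewrite (_ : 'Im 0 = 0) ?mulr0 ?oppr0 // raddf0.
have CRe : Lam + Cm = ReMx Lam.
  rewrite CE; apply/matrixP => i j; rewrite !mxE.
  by rewrite [X in X - _]Crect addrK.
split; first by rewrite dl1E CE /comm mulNmx mulmxN opprK addrC.
by rewrite /comm mulmxN mulNmx opprK -CRe -{1}TC l2T opprB subrK.
Qed.

(** Substituting [dl = l E - E l] in [l dY = Lam dl - dl Y], the terms with [E] on the far left
    cancel because [E] commutes with [Lam] and [l Y = Lam l]; what remains is [l (Y E - E Y)]. *)
Lemma frame_conj_derivative (l Y dl dY E : M) :
  l \in unitmx -> E *m Lam = Lam *m E ->
  l *m Y = Lam *m l -> dl *m Y + l *m dY = Lam *m dl ->
  dl = comm l E -> dY = comm Y E.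
Proof.
move=> ul EL lY h dlE.
have {h} : l *m dY = Lam *m dl - dl *m Y by rewrite -h addrC addKr.
rewrite dlE /comm mulmxBr mulmxBl -!mulmxA lY !mulmxA -lY EL.
rewrite opprB addrA subrK -!mulmxA -mulmxBr => /(congr1 (mulmx (invmx l))).
by rewrite !mulKmx.
Qed.

End TodaAlgebra.

(** * Complex-valued functions of a real variable *)

Section ComplexDerivatives.
Context {R : realType}.
Local Notation C := R[i].
Local Notation Re := (@complex.Re R).
Local Notation Im := (@complex.Im R).
Implicit Types (f g : R -> C) (t : R).

(** This is the entrywise clause of [mx_deriv], so a proof of [mx_deriv] is literally a family of
    proofs of [cderiv]. *)
Definition cderiv f t (d : C) : Prop :=
  is_derive t (1 : R) (fun s => Re (f s)) (Re d) /\
  is_derive t (1 : R) (fun s => Im (f s)) (Im d).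

Definition cderivable f t : Prop := exists d, cderiv f t d.

Lemma cderiv_cst (c : C) t : cderiv (fun=> c) t 0.
Proof. by split; exact: is_derive_cst. Qed.

Lemma cderivD f g t df dg : cderiv f t df -> cderiv g t dg ->
  cderiv (fun s => f s + g s) t (df + dg).
Proof.
move=> [fr fi] [gr gi]; split.
  rewrite (_ : (fun s => _) = (fun s => Re (f s)) + (fun s => Re (g s))).
    rewrite (_ : Re _ = Re df + Re dg); first exact: is_deriveD.
    by case: df {fr fi} => ? ?; case: dg {gr gi}.
  by apply/funext => s /=; rewrite fctE; case: (f s); case: (g s).
rewrite (_ : (fun s => _) = (fun s => Im (f s)) + (fun s => Im (g s))).
  rewrite (_ : Im _ = Im df + Im dg); first exact: is_deriveD.
    by case: df {fr fi} => ? ?; case: dg {gr gi}.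
by apply/funext => s /=; rewrite fctE; case: (f s); case: (g s).
Qed.

Lemma cderivM f g t df dg : cderiv f t df -> cderiv g t dg ->
  cderiv (fun s => f s * g s) t (df * g t + f t * dg).
Proof.
move=> [fr fi] [gr gi]; split.
  rewrite (_ : (fun s => _) = (fun s => Re (f s)) * (fun s => Re (g s)) -
                              (fun s => Im (f s)) * (fun s => Im (g s))).
    apply: (is_derive_eq (is_deriveB (is_deriveM fr gr) (is_deriveM fi gi))).
    rewrite /GRing.scale /=; case: df {fr fi} => ? ?; case: dg {gr gi} => ? ?.
    by case: (f t) => ? ?; case: (g t) => ? ? /=; ring.
  by apply/funext => s /=; rewrite !fctE; case: (f s) => ? ?; case: (g s).
rewrite (_ : (fun s => _) = (fun s => Re (f s)) * (fun s => Im (g s)) +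
                            (fun s => Im (f s)) * (fun s => Re (g s))).
  apply: (is_derive_eq (is_deriveD (is_deriveM fr gi) (is_deriveM fi gr))).
  rewrite /GRing.scale /=; case: df {fr fi} => ? ?; case: dg {gr gi} => ? ?.
  by case: (f t) => ? ?; case: (g t) => ? ? /=; ring.
by apply/funext => s /=; rewrite !fctE; case: (f s) => ? ?; case: (g s).
Qed.

Lemma cderivN f t df : cderiv f t df -> cderiv (fun s => - f s) t (- df).
Proof.
move=> df0; have := cderivM (cderiv_cst (-1) t) df0.
rewrite mul0r add0r mulN1r; congr cderiv.
by apply/funext => s; rewrite mulN1r.
Qed.

Lemma cderiv_conj f t df : cderiv f t df ->
  cderiv (fun s => conjc (f s)) t (conjc df).
Proof.
move=> [fr fi]; split.
  rewrite (_ : (fun s => _) = (fun s => Re (f s))); first by case: df fr {fi}.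
  by apply/funext => s; case: (f s).
rewrite (_ : (fun s => _) = - (fun s => Im (f s))).
  by rewrite (_ : Im _ = - Im df); [exact: is_deriveN|case: df {fr fi}].
by apply/funext => s; rewrite fctE; case: (f s).
Qed.

Lemma near_eq_cderiv f g t d : (\forall s \near t, f s = g s) ->
  cderiv f t d -> cderiv g t d.
Proof.
move=> fg [fr fi]; split.
  by apply: near_eq_is_derive fr; apply: filterS fg => s /= ->.
by apply: near_eq_is_derive fi; apply: filterS fg => s /= ->.
Qed.

Lemma eq_cderiv f g t d : f =1 g -> cderiv f t d -> cderiv g t d.
Proof. by move=> /funext ->. Qed.

Lemma eq_cderivable f g t : f =1 g -> cderivable f t -> cderivable g t.
Proof. by move=> /funext ->. Qed.

Lemma cderiv_unique f t d d' : cderiv f t d -> cderiv f t d' -> d = d'.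
Proof.
move=> [[_ r] [_ i]] [[_ r'] [_ i']]; apply/eqP; rewrite eq_complex.
by rewrite -r -r' -i -i' !eqxx.
Qed.

Lemma cderiv_real (f : R -> R) t d :
  is_derive t 1 f d -> cderiv (fun s => (f s)%:C%C) t (d%:C)%C.
Proof. by move=> fd; split => //=; exact: is_derive_cst. Qed.

Lemma cderivable_cst (c : C) t : cderivable (fun=> c) t.
Proof. by exists 0; exact: cderiv_cst. Qed.

Lemma cderivableD f g t : cderivable f t -> cderivable g t ->
  cderivable (fun s => f s + g s) t.
Proof. by move=> [df fd] [dg gd]; exists (df + dg); exact: cderivD. Qed.

Lemma cderivableM f g t : cderivable f t -> cderivable g t ->
  cderivable (fun s => f s * g s) t.
Proof. by move=> [df fd] [dg gd]; eexists; exact: cderivM fd gd. Qed.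

Lemma cderivableN f t : cderivable f t -> cderivable (fun s => - f s) t.
Proof. by move=> [df fd]; exists (- df); exact: cderivN. Qed.

Lemma cderivableB f g t : cderivable f t -> cderivable g t ->
  cderivable (fun s => f s - g s) t.
Proof. by move=> fd /cderivableN; exact: cderivableD. Qed.

Lemma cderivable_conj f t : cderivable f t -> cderivable (fun s => conjc (f s)) t.
Proof. by move=> [df fd]; exists (conjc df); exact: cderiv_conj. Qed.

Lemma near_eq_cderivable f g t : (\forall s \near t, f s = g s) ->
  cderivable f t -> cderivable g t.
Proof. by move=> fg [d fd]; exists d; exact: near_eq_cderiv fd. Qed.

Lemma cderivable_sum (I : Type) (r : seq I) (P : pred I) (f : I -> R -> C) t :
  (forall i, P i -> cderivable (f i) t) ->
  cderivable (fun s => \sum_(i <- r | P i) f i s) t.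
Proof.
move=> fd; elim: r => [|i r IH].
  rewrite (_ : (fun s => _) = (fun=> 0)); first exact: cderivable_cst.
  by apply/funext => s; rewrite big_nil.
rewrite (_ : (fun s => _) =
  (fun s => (if P i then f i s else 0) + \sum_(i <- r | P i) f i s)).
  apply: cderivableD IH; case Pi: (P i); last exact: cderivable_cst.
  exact: fd.
by apply/funext => s; rewrite big_cons; case: ifP; rewrite ?add0r.
Qed.

Lemma cderiv_sum (n : nat) (f : 'I_n -> R -> C) (d : 'I_n -> C) t :
  (forall i, cderiv (f i) t (d i)) ->
  cderiv (fun s => \sum_(i < n) f i s) t (\sum_(i < n) d i).
Proof.
elim: n f d => [|n IH] f d fd.
  rewrite big_ord0 (_ : (fun s => _) = (fun=> 0)); first exact: cderiv_cst.
  by apply/funext => s; rewrite big_ord0.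
rewrite big_ord_recl (_ : (fun s => _) =
  (fun s => f ord0 s + \sum_(i < n) f (lift ord0 i) s)).
  by apply: cderivD => //; exact: IH.
by apply/funext => s; rewrite big_ord_recl.
Qed.

Lemma cderivable_Re f t : cderivable f t -> derivable (fun s => Re (f s)) t 1.
Proof. by move=> [d [[]]]. Qed.

Lemma cderivable_Im f t : cderivable f t -> derivable (fun s => Im (f s)) t 1.
Proof. by move=> [d [_ []]]. Qed.

Lemma derivable_continuous (f : R -> R) t : derivable f t 1 -> {for t, continuous f}.
Proof. by move=> /derivable1_diffP /differentiable_continuous. Qed.

Lemma cderivable_near_neq0 f t : cderivable f t -> f t != 0 ->
  \forall s \near t, f s != 0.
Proof.
move=> fd; rewrite eq_complex negb_and => /orP[h|h].
  have cf := derivable_continuous (cderivable_Re fd).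
  have nb : nbhs (Re (f t)) [set x | x != 0].
    by apply: open_nbhs_nbhs; split => //; exact: open_neq.
have : \forall s \near t, Re (f s) != 0 := cf _ nb.
  by apply: filterS => s /=; rewrite eq_complex => /negbTE ->.
have cf := derivable_continuous (cderivable_Im fd).
have nb : nbhs (Im (f t)) [set x | x != 0].
    by apply: open_nbhs_nbhs; split => //; exact: open_neq.
have : \forall s \near t, Im (f s) != 0 := cf _ nb.
by apply: filterS => s /=; rewrite eq_complex => /negbTE ->; rewrite andbF.
Qed.

(** Writing [1 / f] as the conjugate of [f] over [|f|^2] reduces the claim to the inverse of a real
    function. *)
Lemma cderivable_inv f t : cderivable f t -> f t != 0 ->
  cderivable (fun s => (f s)^-1) t.
Proof.
move=> fd f0.
pose N s := Re (f s) ^+ 2 + Im (f s) ^+ 2.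
have N0 : N t != 0.
  by move: f0; rewrite eq_complex /N paddr_eq0 ?sqr_ge0 // !sqrf_eq0.
have dN : derivable N t 1.
  rewrite (_ : N = (fun s => Re (f s)) ^+ 2 + (fun s => Im (f s)) ^+ 2).
    by case: fd => d [fr fi]; have [] := is_deriveD (is_deriveX 2 fr) (is_deriveX 2 fi).
  by apply/funext => s; rewrite fctE.
have dNV : derivable (fun s => (N s)^-1) t 1 by exact: derivableV.
have -> : (fun s => (f s)^-1) = (fun s => conjc (f s) * ((N s)^-1)%:C%C).
  by apply/funext => s; rewrite /N; case: (f s) => a b; rewrite /GRing.inv /=; simpc.
apply: cderivableM; first exact: cderivable_conj.
by eexists; apply: cderiv_real; exact: derivableP.
Qed.

Lemma cderivable_sqrt (f : R -> R) t : derivable f t 1 -> 0 < f t ->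
  cderivable (fun s => (Num.sqrt (f s))%:C%C) t.
Proof.
move=> /derivableP fd f0; eexists; apply: cderiv_real.
by apply: (@is_derive1_comp _ Num.sqrt f); exact: is_derive1_sqrt.
Qed.

End ComplexDerivatives.

(** * Derivatives of matrix curves, forward substitution and LU factors *)

Section MatrixDerivatives.
Context {R : realType} {n : nat}.
Local Notation C := R[i].
Local Notation M := 'M[C]_n.
Implicit Types (X Y L U A Z F : R -> M) (t : R).

Definition mx_derivable X t : Prop :=
  forall i j, cderivable (fun s => X s i j) t.

Lemma mx_deriv_derivable X t D : mx_deriv X t D -> mx_derivable X t.
Proof. by move=> h i j; exists (D i j); exact: h. Qed.

Lemma mx_derivableP X t : mx_derivable X t -> exists D, mx_deriv X t D.
Proof.
move=> h; have /choice[f fP] : forall ij : 'I_n * 'I_n,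
    exists d, cderiv (fun s => X s ij.1 ij.2) t d by move=> [i j]; exact: h.
exists (\matrix_(i, j) f (i, j)) => i j; rewrite mxE; exact: (fP (i, j)).
Qed.

Lemma mx_deriv_unique X t D D' : mx_deriv X t D -> mx_deriv X t D' -> D = D'.
Proof. by move=> h h'; apply/matrixP => i j; exact: cderiv_unique (h i j) (h' i j). Qed.

Lemma near_eq_mx_deriv X Y t D : (\forall s \near t, X s = Y s) ->
  mx_deriv X t D -> mx_deriv Y t D.
Proof.
move=> XY h i j; apply: (@near_eq_cderiv _ (fun s => X s i j)) (h i j).
by apply: filterS XY => s ->.
Qed.

Lemma near_eq_mx_derivable X Y t : (\forall s \near t, X s = Y s) ->
  mx_derivable X t -> mx_derivable Y t.
Proof.
move=> XY /mx_derivableP[D h]; apply: (@mx_deriv_derivable _ _ D).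
exact: near_eq_mx_deriv h.
Qed.

Lemma mx_deriv_cst (A : M) t : mx_deriv (fun=> A) t 0.
Proof. by move=> i j; rewrite mxE; exact: cderiv_cst. Qed.

Lemma mx_derivM X Y t dX dY : mx_deriv X t dX -> mx_deriv Y t dY ->
  mx_deriv (fun s => X s *m Y s) t (dX *m Y t + X t *m dY).
Proof.
move=> hX hY i j.
have -> : (dX *m Y t + X t *m dY) i j =
    \sum_k (dX i k * Y t k j + X t i k * dY k j) by rewrite !mxE big_split.
suff: cderiv (fun s => \sum_k X s i k * Y s k j) t
    (\sum_k (dX i k * Y t k j + X t i k * dY k j)).
  by apply: eq_cderiv => s; rewrite mxE.
by apply: cderiv_sum => k; apply: cderivM; [exact: hX|exact: hY].
Qed.

Lemma mx_deriv_adjm X t dX : mx_deriv X t dX ->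
  mx_deriv (fun s => adjm (X s)) t (adjm dX).
Proof.
move=> h i j; rewrite adjmE.
have := cderiv_conj (h j i); apply: eq_cderiv => s.
by rewrite adjmE.
Qed.

Lemma mx_derivable_cst (A : M) t : mx_derivable (fun=> A) t.
Proof. exact: mx_deriv_derivable (mx_deriv_cst A t). Qed.

Lemma mx_derivableM X Y t : mx_derivable X t -> mx_derivable Y t ->
  mx_derivable (fun s => X s *m Y s) t.
Proof.
move=> /mx_derivableP[dX hX] /mx_derivableP[dY hY].
exact: mx_deriv_derivable (mx_derivM hX hY).
Qed.

Lemma mx_derivableB X Y t : mx_derivable X t -> mx_derivable Y t ->
  mx_derivable (fun s => X s - Y s) t.
Proof.
move=> hX hY i j; apply: eq_cderivable (cderivableB (hX i j) (hY i j)) => s.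
by rewrite !mxE.
Qed.

Lemma mx_derivable_adjm X t : mx_derivable X t ->
  mx_derivable (fun s => adjm (X s)) t.
Proof.
by move=> /mx_derivableP[dX hX]; exact: mx_deriv_derivable (mx_deriv_adjm hX).
Qed.

Lemma mx_derivable_diag (d : 'I_n -> R -> C) t : (forall i, cderivable (d i) t) ->
  mx_derivable (fun s => diag_mx (\row_i d i s)) t.
Proof.
move=> h i j; case: (eqVneq i j) => [->|ij].
  apply: eq_cderivable (h j) => s.
  by rewrite !mxE eqxx.
apply: eq_cderivable (cderivable_cst 0 t) => s.
by rewrite !mxE (negbTE ij).
Qed.

(** Forward substitution: [Z i j] is [F i j] minus the sum over [k < i] of [L i k * Z k j], so
    derivability passes from the earlier rows to row [i]. *)
Lemma mx_derivable_Lunip_solve L Z F t :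
  (\forall s \near t, Lunip (L s) /\ L s *m Z s = F s) ->
  mx_derivable L t -> mx_derivable F t -> mx_derivable Z t.
Proof.
move=> LZ dL dF i; have [m] := ubnP (val i); elim: m i => // m IH i im j.
have d1 : cderivable (fun s => F s i j - \sum_(k < n | (k < i)%N) L s i k * Z s k j) t.
  apply: cderivableB; first exact: dF.
  apply: cderivable_sum => k ki; apply: cderivableM; first exact: dL.
  by apply: IH; exact: leq_trans ki im.
apply: near_eq_cderivable d1; apply: filterS LZ => s [Ls <-].
rewrite mxE (bigID (fun k : 'I_n => (k < i)%N)) /= [X in X - _]addrC addrK.
rewrite (bigD1 i) ?ltnn //= (Lunip_diag i Ls) mul1r big1 ?addr0 // => k.
rewrite -leqNgt leq_eqVlt => /andP[/orP[/eqP/val_inj ->|ik _]]; first by rewrite eqxx.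
by case: Ls => ->; rewrite ?mul0r.
Qed.

(** Doolittle's recurrences give row [k] of [U], then column [k] of [L] after division by the pivot
    [U k k]. Nonzero pivots at [t] suffice: a derivable pivot stays nonzero near [t]. *)
Lemma mx_derivable_LU A L U t :
  (\forall s \near t, [/\ Lunip (L s), is_trig_mx (U s)^T & A s = L s *m U s]) ->
  (forall i, U t i i != 0) -> mx_derivable A t ->
  mx_derivable L t /\ mx_derivable U t.
Proof.
move=> LU U0 dA.
suff h k : (forall j, cderivable (fun s => U s k j) t) /\
           (forall j, cderivable (fun s => L s j k) t).
  by split=> i j; [apply: (h j).2|apply: (h i).1].
have [m] := ubnP (val k); elim: m k => // m IH k km.
have dsum i j : cderivable (fun s => \sum_(l < n | (l < k)%N) L s i l * U s l j) t.
  apply: cderivable_sum => l lk; have [] := IH l (leq_trans lk km) => h1 h2.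
  by apply: cderivableM.
have dU j : cderivable (fun s => U s k j) t.
  apply: near_eq_cderivable (cderivableB (dA k j) (dsum k j)).
  apply: filterS LU => s [Ls _ ->].
  rewrite mxE (bigID (fun l : 'I_n => (l < k)%N)) /= [X in X - _]addrC addrK.
  rewrite (bigD1 k) ?ltnn //= (Lunip_diag k Ls) mul1r big1 ?addr0 // => l.
  rewrite -leqNgt leq_eqVlt => /andP[/orP[/eqP/val_inj ->|kl _]]; first by rewrite eqxx.
  by case: Ls => ->; rewrite ?mul0r.
split=> // j.
have dq := cderivableM (cderivableB (dA j k) (dsum j k)) (cderivable_inv (dU k) (U0 k)).
apply: near_eq_cderivable dq.
apply: filterS2 LU (cderivable_near_neq0 (dU k) (U0 k)) => s [_ /is_trig_mxP Us ->] Uk.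
rewrite mxE (bigID (fun l : 'I_n => (l < k)%N)) /= [X in X - _]addrC addrK.
rewrite (bigD1 k) ?ltnn //= big1 ?addr0; first by rewrite mulfK.
move=> l; rewrite -leqNgt leq_eqVlt => /andP[/orP[/eqP/val_inj ->|kl _]].
  by rewrite eqxx.
by have := Us _ _ kl; rewrite mxE => ->; rewrite mulr0.
Qed.

End MatrixDerivatives.

(** * A derivable frame of eigenvectors *)

Section EigenFrame.
Context {R : realType} {n : nat}.
Local Notation C := R[i].
Local Notation M := 'M[C]_n.
Variable lam : 'rV[C]_n.
Hypothesis lam_inj : injective (lam 0).
Local Notation Lam := (diag_mx lam).

Definition shift_prod (r : seq C) (A : M) : M :=
  foldr (fun a B => (A - a%:M) *m B) 1%:M r.

(** A frame that intertwines [A] with [Lam] intertwines every polynomial in [A] with the same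
    polynomial in [Lam]. *)
Lemma shift_prod_frame (r : seq C) (g A : M) : g *m A = Lam *m g ->
  g *m shift_prod r A = diag_mx (\row_i \prod_(a <- r) (lam 0 i - a)) *m g.
Proof.
move=> gA; elim: r => [|a r IH] /=.
  rewrite mulmx1 (_ : (\row_i _) = const_mx 1) ?diag_const_mx ?mul1mx //.
  by apply/rowP => i; rewrite !mxE big_nil.
rewrite mulmxA mulmxBr gA scalar_mxC -mulmxBl -mulmxA IH mulmxA; congr (_ *m _).
rewrite -diag_const_mx -linearB /= mulmx_diag; congr diag_mx.
by apply/rowP => i; rewrite !mxE big_cons.
Qed.

Lemma shift_prod_derivable (r : seq C) (X : R -> M) t :
  mx_derivable X t -> mx_derivable (fun s => shift_prod r (X s)) t.
Proof.
move=> dX; elim: r => [|a r IH] /=; first exact: mx_derivable_cst.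
by apply: mx_derivableM IH; apply: mx_derivableB => //; exact: mx_derivable_cst.
Qed.

(* Row [j] of [W] is row [j] of [g t] times [\prod_(i != j) (X s - lam_i)],
   i.e. an unnormalised spectral projection, which is polynomial in [X s]. *)
Lemma derivable_eigenframe (X g : R -> M) t :
  mx_derivable X t ->
  (\forall s \near t, g s \in unitmx /\ g s *m X s = Lam *m g s) ->
  exists (W : R -> M) (D : R -> 'rV[C]_n),
    [/\ mx_derivable W t, (forall j, D t 0 j != 0),
        \forall s \near t, W s = diag_mx (D s) *m g s &
        \forall s \near t, forall j, D s 0 j != 0].
Proof.
move=> dX gX; have [ug gt] := nbhs_singleton gX.
pose r j := [seq lam 0 a | a <- index_enum 'I_n & a != j].
pose q j i := \prod_(a <- r j) (lam 0 i - a).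
have qE j i : q j i = \prod_(a < n | a != j) (lam 0 i - lam 0 a).
  by rewrite /q /r big_map big_filter.
have q0 j i : i != j -> q j i = 0.
  by move=> ij; rewrite qE (bigD1 i) //= subrr mul0r.
have qn0 j : q j j != 0.
  rewrite qE; apply/prodf_neq0 => a aj; rewrite subr_eq0.
  by apply: contra aj => /eqP /lam_inj ->.
(* The frame is frozen at [t], so [W s] depends on [s] only through [X s]. The scale [D s] compares
   it with the frame [g s], about whose regularity nothing is known. *)
pose W s : M := \matrix_(j, m) (g t *m shift_prod (r j) (X s)) j m.
pose D s : 'rV[C]_n := \row_j ((g t *m invmx (g s)) j j * q j j).
have D0 j : D t 0 j != 0 by rewrite mxE mulmxV // mxE eqxx mul1r.
have WD : \forall s \near t, W s = diag_mx (D s) *m g s.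
  apply: filterS gX => s [us gXs]; apply/matrixP => j m.
  have gE : g t *m shift_prod (r j) (X s) =
      g t *m invmx (g s) *m (diag_mx (\row_i q j i) *m g s).
    by rewrite -(shift_prod_frame (r j) gXs) mulmxA mulmxKV.
  rewrite [LHS]mxE gE [LHS]mxE !mul_diag_mx [RHS]mxE (bigD1 j) //= big1 => [|a aj].
    by rewrite addr0 !mxE mulrA.
  by rewrite !mxE q0 // mul0r mulr0.
have dW : mx_derivable W t.
  move=> j m; apply: (@eq_cderivable _ (fun s => (g t *m shift_prod (r j) (X s)) j m)).
    by move=> s; rewrite [RHS]mxE.
  apply: mx_derivableM; first exact: mx_derivable_cst.
  exact: shift_prod_derivable.
exists W, D; split => //.
apply: (@filter_forall R 'I_n (fun j s => D s 0 j != 0) (nbhs t)) => j.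
(* [D] is not known to be continuous, so its nonvanishing near [t] is read off the derivable [W]: if
   [D s 0 j] were zero, row [j] of [W s] would vanish. *)
have dWj : cderivable (fun s => (W s *m invmx (g t)) j j) t.
  by apply: mx_derivableM => //; exact: mx_derivable_cst.
have Wj0 : (W t *m invmx (g t)) j j != 0.
  by rewrite (nbhs_singleton WD) mulmxK // [X in X != 0]mxE eqxx; exact: D0.
apply: filterS2 WD (cderivable_near_neq0 dWj Wj0) => s -> /=.
by apply: contraNneq => Dj; rewrite -mulmxA mul_diag_mx mxE Dj mul0r.
Qed.

End EigenFrame.

(** * Rescaling by invertible diagonal matrices *)

Section DiagonalScaling.
Context {F : fieldType} {n : nat}.
Implicit Types (d : 'rV[F]_n).

Lemma diag_mx_mulV d : (forall j, d 0 j != 0) ->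
  diag_mx d *m diag_mx (\row_j (d 0 j)^-1) = 1%:M.
Proof.
move=> d0; rewrite mulmx_diag -diag_const_mx; congr diag_mx.
by apply/rowP => j; rewrite !mxE divff.
Qed.

Lemma diag_mx_Vmul d : (forall j, d 0 j != 0) ->
  diag_mx (\row_j (d 0 j)^-1) *m diag_mx d = 1%:M.
Proof. by move=> d0; rewrite diag_mxC diag_mx_mulV. Qed.

(** Meant for [k'] the adjoint of a unitary [k]: the unitary part drops out of the Gram matrix of
    the frame [D l k], and the right-hand side is its LU factorisation once [V] is the inverse of
    [D]. *)
Lemma scale_gram (D V l k k' l' D' : 'M[F]_n) :
  V *m D = 1%:M -> k *m k' = 1%:M ->
  D *m (l *m k) *m (k' *m l' *m D') = D *m l *m V *m (D *m l' *m D').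
Proof.
move=> VD kk; rewrite -!mulmxA (mulmxA V) VD mul1mx (mulmxA k) kk mul1mx.
by [].
Qed.

End DiagonalScaling.

(** * Derivability of the factors and of [Y], [Z] *)

Section YZDerivatives.
Context {R : realType} {n : nat}.
Local Notation C := R[i].
Local Notation M := 'M[C]_n.
Variable lam : 'rV[C]_n.
Hypothesis lam_inj : injective (lam 0).
Local Notation Lam := (diag_mx lam).

Lemma Lunip_scale (d : 'rV[C]_n) (l : M) : (forall j, d 0 j != 0) -> Lunip l ->
  Lunip (diag_mx d *m l *m diag_mx (\row_j (d 0 j)^-1)).
Proof.
move=> d0 Ll; split=> [i j ij|i]; rewrite mul_mx_diag mul_diag_mx !mxE.
  by case: Ll => -> //; rewrite mulr0 mul0r.
by rewrite Lunip_diag // mulr1 divff.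
Qed.

Lemma yz_data_derivable (X Y Z l1 k l2 u : R -> M) t :
  mx_derivable X t ->
  (\forall s \near t, yz_data lam (X s) (Y s) (Z s) (l1 s) (k s) (l2 s) (u s)) ->
  [/\ mx_derivable l1 t, mx_derivable k t, mx_derivable l2 t, mx_derivable u t &
      mx_derivable Y t /\ mx_derivable Z t].
Proof.
move=> dX yz; have [[L1t Skt L2t Ut] _ _ _ _] := nbhs_singleton yz.
have gX : \forall s \near t, l1 s *m k s \in unitmx /\
    l1 s *m k s *m X s = Lam *m (l1 s *m k s).
  apply: filterS yz => s [[L1 Sk _ _] _ ? _ _].
  by rewrite unitmx_mul Lunip_unit ?SUn_unit.
have [W [D [dW D0 WD Dn0]]] := derivable_eigenframe lam_inj dX gX.
pose Dg s : M := diag_mx (D s); pose Dv s : M := diag_mx (\row_j (D s 0 j)^-1).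
(* [W = D l2 u^-1] has the LU factors [D l2 D^-1] and [D u^-1]. *)
have [dL2 dU] : mx_derivable (fun s => Dg s *m l2 s *m Dv s) t /\
    mx_derivable (fun s => Dg s *m invmx (u s)) t.
  apply: (@mx_derivable_LU _ _ W) => //; last first.
    move=> i; rewrite mul_diag_mx mxE invmx_uptrig_diag ?Upos_unit ?Upos_uptrig //.
    by rewrite mulf_neq0 // invr_eq0 gt_eqF // Upos_diag_gt0.
  apply: filterS3 yz WD Dn0 => s [[L1 Sk L2 Us] kuE _ _ _] -> Ds; split.
  - exact: Lunip_scale.
  - rewrite mulmx_is_uptrig ?tr_diag_mx ?diag_mx_is_trig //.
    by rewrite invmx_is_uptrig ?Upos_unit ?Upos_uptrig.
  - rewrite -kuE -[RHS]mulmxA [Dv s *m _]mulmxA diag_mx_Vmul // mul1mx.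
    by rewrite -!mulmxA mulmxV ?Upos_unit // mulmx1.
have rE s j : Lunip (l1 s) -> (Dg s *m adjm (l1 s) *m adjm (Dg s)) j j =
    D s 0 j * conjc (D s 0 j).
  move=> L1; have tD : is_trig_mx (Dg s)^T by rewrite tr_diag_mx diag_mx_is_trig.
  have tl : is_trig_mx (adjm (l1 s))^T by rewrite adjm_uptrig // Lunip_trig.
  have tD' : is_trig_mx (adjm (Dg s))^T by rewrite adjm_uptrig // diag_mx_is_trig.
  rewrite (mulmx_uptrig_diag _ _ tD') ?mulmx_is_uptrig // (mulmx_uptrig_diag _ tD tl).
  by rewrite !adjmE Lunip_diag // conjc1 mulr1 !mxE eqxx.
(* The Gram matrix [W *m adjm W] no longer contains [k]; its LU factors involve only [D] and
   [l1]. *)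
have [dL1 dr] : mx_derivable (fun s => Dg s *m l1 s *m Dv s) t /\
    mx_derivable (fun s => Dg s *m adjm (l1 s) *m adjm (Dg s)) t.
  have adjD s : adjm (Dg s) = diag_mx (\row_j (conjc (D s 0 j))).
    apply/matrixP => i j; rewrite adjmE !mxE eq_sym.
    by case: eqVneq => [->|_] //; rewrite mulr0n conjc0.
  apply: (@mx_derivable_LU _ _ (fun s => W s *m adjm (W s))).
  - apply: filterS3 yz WD Dn0 => s [[L1 Sk L2 Us] kuE _ _ _] -> Ds; split.
    + exact: Lunip_scale.
    + rewrite adjD !mulmx_is_uptrig ?tr_diag_mx ?diag_mx_is_trig //.
      by rewrite adjm_uptrig // Lunip_trig.
    + rewrite (adjm_mul (Dg s)) (adjm_mul (l1 s)); case: Sk => kk _.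
      exact: scale_gram (diag_mx_Vmul Ds) kk.
  - move=> i; by rewrite rE // mulf_neq0 // conjc_eq0.
  - by apply: mx_derivableM => //; exact: mx_derivable_adjm.
(* [a] and [r] are the diagonals of the two upper factors just obtained. The scale [D] cancels in
   [r / |a|^2], which is the square of [u_jj]. *)
pose a j s : C := D s 0 j / u s j j; pose r j s : C := D s 0 j * conjc (D s 0 j).
have da j : cderivable (a j) t.
  apply: near_eq_cderivable (dU j j); apply: filterS yz => s [[_ _ _ Us] _ _ _ _].
  by rewrite mul_diag_mx mxE invmx_uptrig_diag ?Upos_unit ?Upos_uptrig.
have dr' j : cderivable (r j) t.
  apply: near_eq_cderivable (dr j j); apply: filterS yz => s [[L1 _ _ _] _ _ _ _].
  exact: rE.
have uu s j : Upos (u s) -> u s j j = (complex.Re (u s j j))%:C%C.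
  by move=> Us; rewrite RRe_real // gtr0_real // Upos_diag_gt0.
have u0 s j : Upos (u s) -> 0 < complex.Re (u s j j).
  by move=> Us; rewrite -ltcR -uu // Upos_diag_gt0.
have raE j s : Upos (u s) -> D s 0 j != 0 ->
    r j s / (a j s * conjc (a j s)) = ((complex.Re (u s j j)) ^+ 2)%:C%C.
  have conjc_div (z : C) (x : R) : conjc (z / (x%:C)%C) = conjc z / (x%:C)%C.
    by rewrite -[in RHS]conjc_real -conjc_inv -rmorphM.
  move=> Us Ds; have := uu s j Us; have := u0 s j Us; rewrite /r /a.
  move: (complex.Re _) => x x0 ->; rewrite conjc_div rmorphXn /=.
  have {}x0 : (x%:C)%C != 0 by rewrite gt_eqF // ltcR.
  have : conjc (D s 0 j) != 0 by rewrite conjc_eq0.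
  by move: (x%:C)%C x0 (conjc _) => z z0 y y0; field; rewrite z0 y0 Ds.
have du j : cderivable (fun s => u s j j) t.
  have d1 : cderivable (fun s => r j s / (a j s * conjc (a j s))) t.
    apply: cderivableM => //; apply: cderivable_inv.
      by apply: cderivableM => //; exact: cderivable_conj.
    have a0 : a j t != 0 by rewrite mulf_neq0 // invr_eq0 gt_eqF // Upos_diag_gt0.
    by rewrite mulf_neq0 // conjc_eq0.
  have d2 := cderivable_sqrt (cderivable_Re d1).
  apply: near_eq_cderivable (d2 _); last first.
    by rewrite raE //= exprn_gt0 // u0.
  apply: filterS2 yz Dn0 => s [[_ _ _ Us] _ _ _ _] Ds.
  by rewrite raE //= sqrtr_sqr ger0_norm ?ltW ?u0 // -uu.
have dDj j : cderivable (fun s => D s 0 j) t.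
  apply: near_eq_cderivable (cderivableM (da j) (du j)).
  apply: filterS yz => s [[_ _ _ Us] _ _ _ _].
  by rewrite /a divfK // gt_eqF // Upos_diag_gt0.
have dDg : mx_derivable Dg t.
  apply: near_eq_mx_derivable (mx_derivable_diag dDj).
  by apply: filterS yz => s _; congr diag_mx; apply/rowP => j; rewrite mxE.
have dDv : mx_derivable Dv t.
  by apply: mx_derivable_diag => j; exact: cderivable_inv.
(* With [u_jj] known, [D_j = a_j u_jj] is derivable, and conjugating back by [D] frees [l1] and [l2]
   from the scaling. *)
have unscale l : mx_derivable (fun s => Dg s *m l s *m Dv s) t -> mx_derivable l t.
  move=> dl; apply: near_eq_mx_derivable (mx_derivableM (mx_derivableM dDv dl) dDg).
  apply: filterS Dn0 => s Ds.
  rewrite !mulmxA diag_mx_Vmul // mul1mx -mulmxA diag_mx_Vmul // mulmx1 //.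
have dl1 := unscale _ dL1; have dl2 := unscale _ dL2.
(* [k] solves [l1 k = D^-1 W]. Next, [k u] solves [l1 (k u) = l2], and [u] is the adjoint of [k]
   times [k u]. *)
have dk : mx_derivable k t.
  apply: (@mx_derivable_Lunip_solve _ _ l1 k (fun s => Dv s *m W s)) => //.
    apply: filterS3 yz WD Dn0 => s [[L1 _ _ _] _ _ _ _] -> Ds; split => //.
    by rewrite mulmxA diag_mx_Vmul // mul1mx.
  exact: mx_derivableM.
have dku : mx_derivable (fun s => k s *m u s) t.
  apply: (@mx_derivable_Lunip_solve _ _ l1 _ l2) => //.
  by apply: filterS yz => s [[L1 _ _ _] <- _ _ _]; rewrite mulmxA.
split => //.
- apply: near_eq_mx_derivable (mx_derivableM (mx_derivable_adjm dk) dku).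
  by apply: filterS yz => s [[_ Sk _ _] _ _ _ _]; rewrite mulmxA SUn_mulVmx // mul1mx.
- split.
    apply: (@mx_derivable_Lunip_solve _ _ l1 _ (fun s => Lam *m l1 s)) => //.
      by apply: filterS yz => s [[L1 _ _ _] _ _ -> _].
    by apply: mx_derivableM => //; exact: mx_derivable_cst.
  apply: (@mx_derivable_Lunip_solve _ _ l2 _ (fun s => Lam *m l2 s)) => //.
    by apply: filterS yz => s [[_ _ L2 _] _ _ _ ->].
  by apply: mx_derivableM => //; exact: mx_derivable_cst.
Qed.

End YZDerivatives.

(** * The Toda field in the variables [Y] and [Z] *)

Section TodaTransform.
Context {R : realType} {n : nat}.
Local Notation C := R[i].
Local Notation M := 'M[C]_n.

Lemma mx_deriv_near_cst (A : R -> M) t D i j c : mx_deriv A t D ->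
  (\forall s \near t, A s i j = c) -> D i j = 0.
Proof.
move=> dA Ac; apply: (cderiv_unique (dA i j)).
by apply: near_eq_cderiv (cderiv_cst c t); apply: filterS Ac => s ->.
Qed.

Lemma mx_deriv_Lunip_slower (l : R -> M) t D : mx_deriv l t D ->
  (\forall s \near t, Lunip (l s)) -> slower D.
Proof.
move=> dl Ll i j; rewrite leq_eqVlt => /orP[/eqP/val_inj <-|ij].
  by apply: (mx_deriv_near_cst (c := 1) dl); apply: filterS Ll => s; exact: Lunip_diag.
by apply: (mx_deriv_near_cst (c := 0) dl); apply: filterS Ll => s [->].
Qed.

Variable lam : 'rV[C]_n.
Hypothesis lam_inj : injective (lam 0).
Local Notation Lam := (diag_mx lam).

Lemma diag_mx_comm_map (f : C -> C) : f 0 = 0 ->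
  map_mx f Lam *m Lam = Lam *m map_mx f Lam.
Proof.
move=> f0; have -> : map_mx f Lam = diag_mx (map_mx f lam).
  by apply/matrixP => i j; rewrite !mxE; case: eqP => //= _; rewrite !mulr0n.
exact: diag_mxC.
Qed.

Lemma toda_yz_deriv (X Y Z : R -> M) P t :
  mx_deriv X t (comm (X t) P) -> su_alg P -> b_alg (X t - P) ->
  (\forall s \near t, phi_rel Lam (X s) (Y s) (Z s)) ->
  mx_deriv Y t (comm (Y t) (iImMx Lam)) /\ mx_deriv Z t (comm (Z t) (- ReMx Lam)).
Proof.
move=> dX suP bP phi.
(* Factors are chosen independently at each [s], with zero matrices as default where [phi_rel]
   fails; near [t] it holds. *)
have /choice[q qP] : forall s, exists q : (M * M) * (M * M),
    phi_rel Lam (X s) (Y s) (Z s) ->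
    yz_data lam (X s) (Y s) (Z s) q.1.1 q.1.2 q.2.1 q.2.2.
  move=> s; case: (pselect (phi_rel Lam (X s) (Y s) (Z s))) => [h|h].
  2: by exists ((0, 0), (0, 0)).
  by have [l1 [k [l2 [u ?]]]] := phi_rel_yz_data lam_inj h; exists ((l1, k), (l2, u)).
pose l1 s := (q s).1.1; pose k s := (q s).1.2.
pose l2 s := (q s).2.1; pose u s := (q s).2.2.
have yz : \forall s \near t, yz_data lam (X s) (Y s) (Z s) (l1 s) (k s) (l2 s) (u s).
  by apply: filterS phi => s; exact: qP.
have [] := yz_data_derivable lam_inj (mx_deriv_derivable dX) yz.
move=> /mx_derivableP[dl1 d1] /mx_derivableP[dk d2] /mx_derivableP[dl2 d3].
move=> /mx_derivableP[du d4] [/mx_derivableP[dY d5] /mx_derivableP[dZ d6]].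
have [[L1 Sk L2 Uu] kuE gX lY lZ] := nbhs_singleton yz.
have dcst (A : R -> M) dA : mx_deriv A t dA ->
    mx_deriv (fun s => Lam *m A s) t (Lam *m dA).
  by move=> hA; have := mx_derivM (mx_deriv_cst Lam t) hA; rewrite mul0mx add0r.
have dg := mx_derivM d1 d2.
(* The side conditions come from identities or constraints valid near [t]: differentiate both sides
   and use uniqueness of derivatives. *)
have [||||||||||||||| dl1E dl2E] := @toda_frame_derivative _ _ lam lam_inj (X t) P
  (l1 t) (k t) (l2 t) (u t) dl1 dk dl2 du => //.
- by apply: (mx_deriv_Lunip_slower d1); apply: filterS yz => s [[]].
- by apply: (mx_deriv_Lunip_slower d3); apply: filterS yz => s [[]].
- apply/is_trig_mxP => i j ij; rewrite mxE.
  apply: (mx_deriv_near_cst (c := 0) d4); apply: filterS yz => s [[_ _ _ [h _]] _ _ _ _].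
  exact: h.
- move=> i; have [_ [_ di]] := d4 i i.
  (* Near [t] the diagonal of [u] is positive, so its imaginary part is locally zero and the
     derivative is real. *)
  have : 'D_1 (fun s => complex.Im (u s i i)) t = 0.
    rewrite (@near_eq_derive _ _ _ _ (fun=> 0)) ?derive_cst //.
    apply: filterS yz => s [[_ _ _ Us] _ _ _ _].
    by apply: ger0_Im; rewrite ltW // Upos_diag_gt0.
  by rewrite di; case: (du i i) => a b /= ->; rewrite complex_real.
- apply: (mx_deriv_unique (mx_derivM dg dX)).
  apply: near_eq_mx_deriv (dcst _ _ dg).
  by apply: filterS yz => s [_ _ -> _ _].
- apply: (mx_deriv_unique (mx_derivM dg d4)).
  by apply: near_eq_mx_deriv d3; apply: filterS yz => s [_ -> _ _ _].
- apply: (mx_deriv_unique (mx_derivM d2 (mx_deriv_adjm d2))).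
  apply: near_eq_mx_deriv (mx_deriv_cst 1%:M t).
  by apply: filterS yz => s [[_ [-> _] _ _] _ _ _ _].
have ImC : iImMx Lam *m Lam = Lam *m iImMx Lam.
  by apply: diag_mx_comm_map; rewrite raddf0 mulr0.
have ReC : (- ReMx Lam) *m Lam = Lam *m (- ReMx Lam).
  by rewrite mulNmx mulmxN; congr (- _); apply: diag_mx_comm_map; rewrite raddf0.
rewrite -(frame_conj_derivative (Lunip_unit L1) ImC lY _ dl1E (dY := dY)).
  rewrite -(frame_conj_derivative (Lunip_unit L2) ReC lZ _ dl2E (dY := dZ)) //.
  apply: (mx_deriv_unique (mx_derivM d3 d6)).
  by apply: near_eq_mx_deriv (dcst _ _ d3); apply: filterS yz => s [_ _ _ _ ->].
apply: (mx_deriv_unique (mx_derivM d1 d5)).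
by apply: near_eq_mx_deriv (dcst _ _ d1); apply: filterS yz => s [_ _ _ -> _].
Qed.

End TodaTransform.

(** * Scalar linear equations *)

Section LinearFlow.
Context {R : realType}.
Local Notation C := R[i].

Lemma is_derive_mull (x t : R) : is_derive t (1 : R) (fun s => x * s) x.
Proof.
rewrite (_ : (fun s => _) = x \*: id); last by [].
by apply: is_derive_eq; rewrite /GRing.scale /= mulr1.
Qed.

(** The function [exp (c t)], written by Euler's formula so that only real derivatives are
    needed. *)
Definition cexp (c : C) (t : R) : C :=
  Complex (expR (complex.Re c * t) * cos (complex.Im c * t))
          (expR (complex.Re c * t) * sin (complex.Im c * t)).

Lemma cexp0 c : cexp c 0 = 1.
Proof. by rewrite /cexp !mulr0 expR0 cos0 sin0 mulr1 mulr0. Qed.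

Lemma cexp0l t : cexp 0 t = 1.
Proof. by rewrite /cexp /= !mul0r expR0 cos0 sin0 mulr1 mulr0. Qed.

Lemma cderiv_cexp c t : cderiv (cexp c) t (c * cexp c t).
Proof.
case: c => a b; rewrite /cexp /=.
have dE := is_derive1_comp (is_derive_expR (a * t)) (is_derive_mull a t).
have dC := is_derive1_comp (is_derive_cos (b * t)) (is_derive_mull b t).
have dS := is_derive1_comp (is_derive_sin (b * t)) (is_derive_mull b t).
split => /=.
  rewrite (_ : (fun s => _) = (expR \o (fun s => a * s)) * (cos \o (fun s => b * s))) //.
  by apply: is_derive_eq; rewrite /GRing.scale /=; ring.
rewrite (_ : (fun s => _) = (expR \o (fun s => a * s)) * (sin \o (fun s => b * s))) //.
by apply: is_derive_eq; rewrite /GRing.scale /=; ring.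
Qed.

(** The derivative of [|f|^2] is [2 Re c |f|^2], which is zero. *)
Lemma cderiv_imaginary_norm_cst (f : R -> C) (c : C) : complex.Re c = 0 ->
  (forall t, cderiv f t (c * f t)) ->
  forall t, complex.Re (f t) ^+ 2 + complex.Im (f t) ^+ 2 =
            complex.Re (f 0) ^+ 2 + complex.Im (f 0) ^+ 2.
Proof.
move=> c0 df t.
pose N := (fun s => complex.Re (f s)) ^+ 2 + (fun s => complex.Im (f s)) ^+ 2.
have NE s : N s = complex.Re (f s) ^+ 2 + complex.Im (f s) ^+ 2 by rewrite /N !fctE.
suff: N t = N 0 by rewrite !NE.
apply: is_derive_0_is_cst => s; have [dr di] := df s.
apply: (is_derive_eq (is_deriveD (is_deriveX 2 dr) (is_deriveX 2 di))).
rewrite /GRing.scale /=.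
by case: c c0 {df dr di} => a b /= ->; case: (f s) => x y /=; ring.
Qed.

(** The integrating factor [exp (- c s)] gives [f s = f 0 * exp (c s)], which is unbounded on the
    line unless [f 0] or [c] is zero. *)
Lemma bounded_exp_growth_cst (f : R -> R) (c B : R) :
  (forall t : R, is_derive t (1 : R) f (c * f t)) -> (forall t, `|f t| <= B) ->
  forall t, f t = f 0.
Proof.
move=> df fB t.
have fE s : f s = f 0 * expR (c * s).
  pose g := f * (expR \o (fun s => (- c) * s)).
  have gE : g s = g 0.
    apply: is_derive_0_is_cst => x.
    have dE := is_derive1_comp (is_derive_expR ((- c) * x)) (is_derive_mull (- c) x).
    by have dfx := df x; apply: is_derive_eq; rewrite /GRing.scale /=; ring.
  have : f s * expR (- c * s) = f 0 by move: gE; rewrite /g !fctE /= mulr0 expR0 mulr1.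
  by move=> <-; rewrite -mulrA -expRD mulNr addNr expR0 mulr1.
have [f0|f0] := eqVneq (f 0) 0; first by rewrite fE f0 mul0r.
have [c0|c0] := eqVneq c 0; first by rewrite fE c0 mul0r expR0 mulr1.
(* At this time, whatever the sign of [c], the exponent is [B / |f 0|]; then [1 + x <= expR x]
   forces [|f| >= |f 0| + B], beyond the bound. *)
have := fB (B / (`|f 0| * c)); rewrite fE normrM [`|expR _|]ger0_norm ?expR_ge0 //.
have nf : 0 < `|f 0| by rewrite normr_gt0.
have -> : c * (B / (`|f 0| * c)) = B / `|f 0| by field; rewrite c0 gt_eqF.
have e1 : `|f 0| * (1 + B / `|f 0|) <= `|f 0| * expR (B / `|f 0|).
  by rewrite ler_pM2l // expR_ge1Dx.
move=> /(le_trans e1); rewrite mulrDr mulr1 [_ * (B / _)]mulrC divfK ?gt_eqF // => h.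
by exfalso; lra.
Qed.

End LinearFlow.

(** * Continuity and compactness for complex matrices *)

Section ComplexTopology.
Context {R : realType}.
Local Notation C := R[i].

Lemma real_complex_continuous : continuous ((fun x : R => (x%:C)%C) : R -> C^o).
Proof.
move=> x A /nbhs_ballP[e]; case: e => e1 e2 /=.
(* Positivity of the radius in the partial order of [C] makes its imaginary part vanish, so [e1] is
   a real radius. *)
rewrite ltcE /= => /andP[/eqP -> e0] h.
apply/nbhs_ballP; exists e1 => //= y xy; apply: h.
rewrite /ball /= -rmorphB /= normc_def /= expr0n addr0 sqrtr_sqr ltcR.
exact: xy.
Qed.

Lemma Re_continuous : continuous (@complex.Re R : C^o -> R).
Proof.
move=> x A /nbhs_ballP[e /= e0 h]; apply/nbhs_ballP; exists (e%:C)%C => /=.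
  by rewrite ltcR.
move=> y; rewrite /ball /= normc_def ltcR => xy; apply: h.
rewrite /ball /= (le_lt_trans _ xy) // -sqrtr_sqr ler_wsqrtr //.
by rewrite raddfB lerDl sqr_ge0.
Qed.

Lemma Im_continuous : continuous (@complex.Im R : C^o -> R).
Proof.
move=> x A /nbhs_ballP[e /= e0 h]; apply/nbhs_ballP; exists (e%:C)%C => /=.
  by rewrite ltcR.
move=> y; rewrite /ball /= normc_def ltcR => xy; apply: h.
rewrite /ball /= (le_lt_trans _ xy) // -sqrtr_sqr ler_wsqrtr //.
by rewrite !raddfB lerDr sqr_ge0.
Qed.

Lemma continuous_mx (T : topologicalType) n (f : T -> 'M[C^o]_n) :
  (forall i j, continuous (fun x => f x i j : C^o)) -> continuous f.
Proof.
move=> h x A [P PA PS].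
apply: (@filterS _ (nbhs x) _
  [set y | forall ij : 'I_n * 'I_n, P ij.1 ij.2 (f y ij.1 ij.2)]).
  by move=> y hy; apply: PS => i j; exact: (hy (i, j)).
by apply: filter_forall => -[i j] /=; apply: h; exact: PA.
Qed.

(** [A] lies in the continuous image of a real cube with side [[-B, B]]. This image is compact,
    hence closed, so it contains the closure of [A]. *)
Lemma bounded_mx_compact_closure n (B : R) (A : set 'M[C^o]_n) :
  (forall M, A M -> forall i j,
    complex.Re (M i j) ^+ 2 + complex.Im (M i j) ^+ 2 <= B ^+ 2) ->
  0 <= B -> compact (closure A).
Proof.
(* One real coordinate per entry and per flag: [true] for the real part, [false] for the imaginary
   part. *)
move=> AB B0; pose N := #|{: bool * ('I_n * 'I_n)}|.
pose idx b (i j : 'I_n) : 'I_N := enum_rank (b, (i, j)).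
pose f (v : 'rV[R]_N) : 'M[C^o]_n := \matrix_(i, j)
  (((v 0 (idx true i j))%:C)%C + 'i%C * ((v 0 (idx false i j))%:C)%C).
have cf : continuous f.
  apply: continuous_mx => i j.
  have -> : (fun v => f v i j) = (fun v : 'rV[R]_N =>
     ((v 0 (idx true i j))%:C)%C + 'i%C * ((v 0 (idx false i j))%:C)%C : C^o).
    by apply/funext => w; rewrite mxE.
  move=> v.
  have cc b : {for v, continuous (fun v : 'rV[R]_N => ((v 0 (idx b i j))%:C)%C : C^o)}.
    apply: (@continuous_comp _ _ _ (fun v : 'rV[R]_N => v 0 (idx b i j))
      (fun x : R => (x%:C)%C : C^o)).
      exact: coord_continuous.
    exact: real_complex_continuous.
  have ci : (fun w : 'rV[R]_N => 'i%C * ((w 0 (idx false i j))%:C)%C : C^o) @ v -->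
      ('i%C * ((v 0 (idx false i j))%:C)%C : C^o).
    exact: (@cvgM C _ (nbhs v) _ (fun=> 'i%C) _ _ _ (cvg_cst _) (cc false)).
  exact: (@cvgD C C^o _ (nbhs v) _ _ _ _ _ (cc true) ci).
pose K := [set v : 'rV[R]_N | forall i, `[- B, B] (v ord0 i)].
have cK : compact K.
  by apply: (@rV_compact R N (fun=> `[- B, B])) => i; exact: segment_compact.
have cfK : compact (f @` K).
  by apply: continuous_compact => //; apply: continuous_subspaceT.
have clK : closed (f @` K) by apply: compact_closed => //; exact: norm_hausdorff.
apply: (subclosed_compact _ cfK); first exact: closed_closure.
rewrite closureE => M; apply; split => // {}M AM.
exists (\row_a (let: (b, (i, j)) := enum_val a in
   if b then complex.Re (M i j) else complex.Im (M i j))).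
  move=> a; rewrite mxE; case: (enum_val a) => b [i j].
  have := AB _ AM i j; case: b; move: (complex.Re _) (complex.Im _) => x y xy.
    rewrite /= in_itv /= -ler_norml -(ler_pXn2r (n := 2)) ?nnegrE // -normrX.
    by rewrite ger0_norm ?sqr_ge0 // (le_trans _ xy) // lerDl sqr_ge0.
  rewrite /= in_itv /= -ler_norml -(ler_pXn2r (n := 2)) ?nnegrE // -normrX.
  by rewrite ger0_norm ?sqr_ge0 // (le_trans _ xy) // lerDr sqr_ge0.
apply/matrixP => i j; rewrite !mxE !enum_rankK.
by rewrite [RHS]complexE.
Qed.

End ComplexTopology.

(** * The linear field given by the bracket with a diagonal matrix *)

Section DiagonalFlow.
Context {R : realType} {n : nat}.
Local Notation C := R[i].
Local Notation M := 'M[C]_n.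
Implicit Types (d lam : 'rV[C]_n) (Y : M).

(** Right multiplication by a diagonal matrix scales columns and left multiplication scales rows, so
    each entry evolves alone; all three properties of the field rest on this formula. *)
Lemma comm_diag_mxE Y d j k :
  comm Y (diag_mx d) j k = (d 0 k - d 0 j) * Y j k.
Proof. by rewrite /comm mul_mx_diag mul_diag_mx !mxE mulrBl mulrC. Qed.

Lemma iImMx_diag lam : iImMx (diag_mx lam) = diag_mx (\row_j ('i * 'Im (lam 0 j))).
Proof.
apply/matrixP => i j; rewrite !mxE; case: eqP => // _.
by rewrite !mulr0n raddf0 mulr0.
Qed.

Lemma ReMx_diag lam : - ReMx (diag_mx lam) = diag_mx (\row_j (- 'Re (lam 0 j))).
Proof.
apply/matrixP => i j; rewrite !mxE; case: eqP => // _.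
by rewrite !mulr0n raddf0 oppr0.
Qed.

Lemma aff_diag_upper lam Y (i j : 'I_n) : aff (diag_mx lam) Y -> (i < j)%N -> Y i j = 0.
Proof.
move=> aY ij; have := aY i j (ltnW ij).
by rewrite !mxE -val_eqE (ltn_eqF ij) mulr0n subr0.
Qed.

Lemma slower_comm_diag lam d Y : aff (diag_mx lam) Y -> slower (comm Y (diag_mx d)).
Proof.
move=> aY i j; rewrite leq_eqVlt comm_diag_mxE => /orP[/eqP/val_inj ->|ij].
  by rewrite subrr mul0r.
by rewrite (aff_diag_upper aY ij) mulr0.
Qed.

(** Entrywise form of [exp (- t d) Y exp (t d)], the solution starting at [Y]. *)
Definition diag_flow d Y (t : R) : M :=
  \matrix_(j, k) (cexp (d 0 k - d 0 j) t * Y j k).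

Lemma diag_flow0 d Y : diag_flow d Y 0 = Y.
Proof. by apply/matrixP => j k; rewrite mxE cexp0 mul1r. Qed.

Lemma diag_flow_aff lam d Y t :
  aff (diag_mx lam) Y -> aff (diag_mx lam) (diag_flow d Y t).
Proof.
move=> aY i j ij; have := aY i j ij; rewrite !mxE.
move: ij; rewrite leq_eqVlt => /orP[/eqP/val_inj ->|ij].
  by rewrite subrr cexp0l mul1r.
by rewrite (aff_diag_upper aY ij) mulr0.
Qed.

Lemma diag_flow_deriv d Y t :
  mx_deriv (diag_flow d Y) t (comm (diag_flow d Y t) (diag_mx d)).
Proof.
move=> j k; rewrite comm_diag_mxE [diag_flow d Y t j k]mxE.
have := cderivM (cderiv_cexp (d 0 k - d 0 j) t) (cderiv_cst (Y j k) t).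
rewrite mulr0 addr0 -mulrA; apply: eq_cderiv => s.
by rewrite mxE.
Qed.

(** All differences [d_k - d_j] are imaginary, so each entry keeps its modulus and the orbit is
    bounded. *)
Lemma compact_closure_imaginary_flow d (Y : R -> M) :
  (forall j, complex.Re (d 0 j) = 0) ->
  (forall t, mx_deriv Y t (comm (Y t) (diag_mx d))) ->
  compact (closure (range (Y : R -> 'M[C^o]_n))).
Proof.
move=> d0 dY.
pose N (i j : 'I_n) := complex.Re (Y 0 i j) ^+ 2 + complex.Im (Y 0 i j) ^+ 2.
have N0 i j : 0 <= N i j by rewrite addr_ge0 ?sqr_ge0.
(* The summand 1 ensures [N i j <= B ^+ 2]: for [S >= 0], [S <= (1 + S)^2], even when [S < 1]. *)
pose B := 1 + \sum_i \sum_j N i j.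
have S0 : 0 <= \sum_i \sum_j N i j by rewrite !sumr_ge0 // => i _; rewrite sumr_ge0.
apply: (@bounded_mx_compact_closure _ _ B) => [A [t _ <-] i j|]; last by rewrite addr_ge0.
rewrite (@cderiv_imaginary_norm_cst _ (fun t => Y t i j) (d 0 j - d 0 i)); last 2 first.
- by rewrite raddfB /= !d0 subrr.
- by move=> s; have := dY s i j; rewrite comm_diag_mxE.
have : N i j <= \sum_i \sum_j N i j.
  rewrite (bigD1 i) //= (bigD1 j) //= -addrA lerDl addr_ge0 ?sumr_ge0 // => k _.
  by rewrite sumr_ge0.
rewrite -/(N i j) /B; move: (N i j) (\sum_i _) S0 => x y y0 xy; nra.
Qed.

(** The real and imaginary parts of each entry solve real equations [f' = c f]. A compact orbit
    bounds them, and bounded solutions on the whole line are constant. *)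
Lemma compact_real_flow d (Z : R -> M) :
  (forall j, complex.Im (d 0 j) = 0) ->
  (forall t, mx_deriv Z t (comm (Z t) (diag_mx d))) ->
  compact (range (Z : R -> 'M[C^o]_n)) <-> forall t, Z t = Z 0.
Proof.
move=> d0 dZ; split => [cZ t|Zc]; last first.
  rewrite (_ : range _ = [set (Z 0 : 'M[C^o]_n)]); first exact: compact_set1.
  apply/seteqP; split => [_ [t _ <-]|_ ->]; [exact: Zc|by exists 0].
have bnd (h : C^o -> R) i j : continuous h -> exists B, forall s, `|h (Z s i j)| <= B.
  move=> ch.
  have : compact ((fun A : 'M[C^o]_n => h (A i j)) @` range (Z : R -> 'M[C^o]_n)).
    apply: continuous_compact cZ; apply: continuous_subspaceT => A.
    apply: (@continuous_comp _ _ _ (fun A : 'M[C^o]_n => A i j : C^o) h); last exact: ch.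
    exact: (@coord_continuous C).
  (* Boundedness is given for every constant above [B]; [B + 1] is one. *)
  move=> /compact_bounded[B [_ hB]]; exists (B + 1) => s.
  by apply: (hB (B + 1)); [rewrite ltrDl|exists (Z s) => //; exists s].
have cE j k : complex.Im (d 0 k - d 0 j) = 0 by rewrite raddfB /= !d0 subrr.
apply/matrixP => j k; apply/eqP; rewrite eq_complex; apply/andP; split; apply/eqP.
  have [B hB] := bnd _ j k Re_continuous.
  apply: (@bounded_exp_growth_cst _ (fun s => complex.Re (Z s j k))
    (complex.Re (d 0 k - d 0 j)) B) => // s.
  have [+ _] := dZ s j k; rewrite comm_diag_mxE; congr is_derive.
  by move: (cE j k); case: (d 0 k - d 0 j) => a b /= ->; case: (Z s j k) => x y /=; ring.
have [B hB] := bnd _ j k Im_continuous.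
apply: (@bounded_exp_growth_cst _ (fun s => complex.Im (Z s j k))
    (complex.Re (d 0 k - d 0 j)) B) => // s.
have [_ +] := dZ s j k; rewrite comm_diag_mxE; congr is_derive.
by move: (cE j k); case: (d 0 k - d 0 j) => a b /= ->; case: (Z s j k) => x y /=; ring.
Qed.

End DiagonalFlow.

(** * The transformed field and its three properties *)

Unset Implicit Arguments.

Theorem theorem2p8 (R : realType) (n : nat) (lam : 'rV[R[i]]_n.+1) :
  injective (lam 0) ->                          (* simple spectrum *)
  \sum_(j < n.+1) lam 0 j = 0 ->                (* Lam in sl_n(C) *)
  let Lam := diag_mx lam in
  let DY := iImMx Lam in
  let DZ := - ReMx Lam in
  (* phi transforms the Toda vector field into the linear one *)
  (forall (I : set R) (X X' Y Z : R -> 'M[R[i]]_n.+1),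
      open I ->
      (forall t, I t -> calU Lam (X t)) ->
      (forall t, I t -> mx_deriv X t (X' t)) ->
      (forall t, I t -> exists P, su_alg P /\ b_alg (X t - P) /\
                                  X' t = comm (X t) P) ->
      (forall t, I t -> phi_rel Lam (X t) (Y t) (Z t)) ->
      forall t, I t -> mx_deriv Y t (comm (Y t) DY) /\
                       mx_deriv Z t (comm (Z t) DZ)) /\
  (* (i) the linear field is defined on the whole affine space *)
  ((forall Y, aff Lam Y -> slower (comm Y DY)) /\
   (forall Z, aff Lam Z -> slower (comm Z DZ)) /\
   (forall Y0 Z0, aff Lam Y0 -> aff Lam Z0 ->
      exists Y Z : R -> 'M[R[i]]_n.+1, Y 0 = Y0 /\ Z 0 = Z0 /\
        (forall t, aff Lam (Y t) /\ aff Lam (Z t)) /\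
        (forall t, mx_deriv Y t (comm (Y t) DY) /\ mx_deriv Z t (comm (Z t) DZ)))) /\
  (* (ii) trajectories *)
  (forall Y Z : R -> 'M[R[i]]_n.+1,
      (forall t, aff Lam (Y t) /\ aff Lam (Z t)) ->
      (forall t, mx_deriv Y t (comm (Y t) DY) /\ mx_deriv Z t (comm (Z t) DZ)) ->
      compact (closure (range (Y : R -> 'M[R[i]^o]_n.+1))) /\
      (compact (range (Z : R -> 'M[R[i]^o]_n.+1)) <-> forall t, Z t = Z 0)) /\
  (* (iii) decoupling in the strictly lower triangular entries *)
  (exists cY cZ : 'I_n.+1 -> 'I_n.+1 -> R[i],
      forall (Y : 'M[R[i]]_n.+1) (j k : 'I_n.+1), aff Lam Y -> (k < j)%N ->
        (comm Y DY) j k = cY j k * Y j k /\ (comm Y DZ) j k = cZ j k * Y j k).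
Proof.
move=> lam_inj _ Lam DY DZ.
set dY := \row_j ('i * 'Im (lam 0 j)); set dZ := \row_j (- 'Re (lam 0 j)).
have DYE : DY = diag_mx dY by exact: iImMx_diag.
have DZE : DZ = diag_mx dZ by exact: ReMx_diag.
split.
  move=> I X X' Y Z oI _ dX toda phi t It.
  have [P [suP [bP X'E]]] := toda t It.
  apply: (toda_yz_deriv lam_inj _ suP bP); first by rewrite -X'E; exact: dX.
  (* Openness of [I] turns the relation on [I] into one valid near [t]. *)
  by apply: filterS (open_nbhs_nbhs (conj oI It)) => s Is; exact: phi.
rewrite DYE DZE; split; [|split].
- split; first by move=> Y; exact: slower_comm_diag.
  split; first by move=> Z; exact: slower_comm_diag.
  move=> Y0 Z0 aY aZ.
  exists (diag_flow dY Y0), (diag_flow dZ Z0); rewrite !diag_flow0; do 2!split => //.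
  by split=> t; split; (exact: diag_flow_aff || exact: diag_flow_deriv).
- move=> Y Z _ dYZ; split.
    apply: (@compact_closure_imaginary_flow _ _ dY) => [j|t]; last by have [] := dYZ t.
    rewrite mxE -complexIm.
    by rewrite /= mul0r mul1r subr0.
  apply: (@compact_real_flow _ _ dZ) => [j|t]; last by have [] := dYZ t.
  by rewrite mxE -complexRe /= oppr0.
- exists (fun j k => dY 0 k - dY 0 j), (fun j k => dZ 0 k - dZ 0 j) => Y j k _ _.
  by split; exact: comm_diag_mxE.
Qed.
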